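(* Let $A$ be a finite set with $|A|\ge 4$. Then the lattice $\mathcal{E}$ is tolerance simple.
   Context: $\operatorname{Eq}(A)$ is the set of all equivalence relations on $A$. A mapping $f\colon A\to A$ preserves $\kappa\in\operatorname{Eq}(A)$ if $(x,y)\in\kappa$ implies $(f(x),f(y))\in\kappa$. For $F\subseteq A^A$, $\operatorname{Con}(A,F)$ is the set of all $\kappa\in\operatorname{Eq}(A)$ preserved by every $f\in F$. $\mathcal{E}:=\{\operatorname{Con}(A,F)\mid F\subseteq A^A\}$, ordered by inclusion; it is a lattice (meet is intersection; the join of two members is the least member of $\mathcal{E}$ containing both). A tolerance of a lattice $V$ is a reflexive and symmetric binary relation $T\subseteq V\times V$ compatible with the lattice operations $\wedge$ and $\vee$. A lattice $V$ is tolerance simple if its only tolerances are $\{(x,x)\mid x\in V\}$ and $V\times V$. *)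

(* Defs.v *)
From HB Require Import structures.
From mathcomp Require Import all_boot all_order.

Set Implicit Arguments.
Unset Strict Implicit.
Unset Printing Implicit Defensive.

Import Order.Theory.

Local Open Scope order_scope.

Section CongruenceLattices.
Variable A : finType.

(* A binary relation on A is the set of its pairs, so that Eq(A) and the
   Con(A, F) are finite sets. *)
Implicit Types (k : {set A * A}) (f : {ffun A -> A}) (F : {set {ffun A -> A}}).

Definition is_equivalence k : bool :=
  [&& [forall x, (x, x) \in k],
      [forall x, forall y, ((x, y) \in k) ==> ((y, x) \in k)] &
      [forall x, forall y, forall z,
         ((x, y) \in k) && ((y, z) \in k) ==> ((x, z) \in k)]].

Definition Eqv : {set {set A * A}} := [set k | is_equivalence k].

Definition preserves f k : bool :=
  [forall x, forall y, ((x, y) \in k) ==> ((f x, f y) \in k)].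

Definition Con F : {set {set A * A}} :=
  [set k in Eqv | [forall f in F, preserves f k]].

Definition calE : {set {set {set A * A}}} :=
  [set Con F | F : {set {ffun A -> A}}].

Lemma in_Con F k :
  (k \in Con F) = (k \in Eqv) && [forall f in F, preserves f k].
Proof. by rewrite /Con inE. Qed.

Lemma calE_Eqv : Eqv \in calE.
Proof.
apply/imsetP; exists set0 => //; apply/setP => k; rewrite in_Con.
case: (k \in Eqv) => //=; symmetry.
by apply/forall_inP => f; rewrite inE.
Qed.

Lemma calE_sub L : L \in calE -> L \subset Eqv.
Proof.
by case/imsetP => F _ ->; apply/subsetP => k; rewrite in_Con => /andP[].
Qed.

Lemma calE_setI L M : L \in calE -> M \in calE -> L :&: M \in calE.
Proof.
case/imsetP => F _ -> /imsetP[G _ ->]; apply/imsetP; exists (F :|: G) => //.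
apply/setP => k; rewrite in_setI !in_Con.
case: (k \in Eqv) => //=; apply/andP/forall_inP.
  by move=> [/forall_inP kF /forall_inP kG] f /setUP[/kF|/kG].
move=> kFG.
by split; apply/forall_inP => f fF; apply: kFG; rewrite inE fF ?orbT.
Qed.

Definition calE_join (L M : {set {set A * A}}) : {set {set A * A}} :=
  \bigcap_(N in calE | (L \subset N) && (M \subset N)) N.

Lemma calE_joinP L M : L \in calE -> M \in calE -> calE_join L M \in calE.
Proof.
move=> LE ME; rewrite /calE_join.
have <- : (\bigcap_(N in calE | (L \subset N) && (M \subset N)) N) :&: Eqv =
          \bigcap_(N in calE | (L \subset N) && (M \subset N)) N.
  by apply/setIidPl/bigcap_inf; rewrite calE_Eqv !calE_sub.
apply: (big_ind (fun X => X :&: Eqv \in calE)) => [|X Y XE YE|N /andP[NE _]].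
- by rewrite setTI calE_Eqv.
- by rewrite setIIl calE_setI.
- by rewrite calE_setI ?calE_Eqv.
Qed.

Definition conlat : Type := {L : {set {set A * A}} | L \in calE}.

HB.instance Definition _ := SubFinite.on conlat.

Implicit Types L M N : conlat.

Definition conlat_le L M : bool := val L \subset val M.

Definition conlat_meet L M : conlat :=
  exist _ (val L :&: val M) (calE_setI (valP L) (valP M)).

Definition conlat_join L M : conlat :=
  exist _ (calE_join (val L) (val M)) (calE_joinP (valP L) (valP M)).

Fact conlat_le_refl : reflexive conlat_le.
Proof. by move=> L; apply: subxx. Qed.

Fact conlat_le_anti : antisymmetric conlat_le.
Proof. by move=> L M LM; apply/val_inj/eqP; rewrite eqEsubset. Qed.

Fact conlat_le_trans : transitive conlat_le.
Proof. by move=> M L N; apply: subset_trans. Qed.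

HB.instance Definition _ := Order.Le_isPOrder.Build
  Order.SetSubsetOrder.subset_display conlat
  conlat_le_refl conlat_le_anti conlat_le_trans.

Fact conlat_meetP L M N : (L <= conlat_meet M N) = (L <= M) && (L <= N).
Proof. exact: subsetI. Qed.

Fact conlat_joinP L M N : (conlat_join L M <= N) = (L <= N) && (M <= N).
Proof.
apply/idP/idP => [JN|LMN]; last by apply: bigcap_inf; rewrite (valP N).
by apply/andP; split; apply: (subset_trans _ JN);
   apply/bigcapsP => K /andP[_ /andP[]].
Qed.

HB.instance Definition _ := Order.POrder_MeetJoin_isLattice.Build
  Order.SetSubsetOrder.subset_display conlat conlat_meetP conlat_joinP.

Lemma conlat_leE L M : (L <= M) = (val L \subset val M).
Proof. by []. Qed.

Lemma conlat_meetE L M : val (L `&` M) = val L :&: val M.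
Proof. by []. Qed.

Lemma conlat_joinE L M : val (L `|` M) =
  \bigcap_(N in calE | (val L \subset N) && (val M \subset N)) N.
Proof. by []. Qed.

End CongruenceLattices.

Definition is_tolerance (d : Order.disp_t) (V : latticeType d)
    (T : V -> V -> Prop) : Prop :=
  [/\ forall x, T x x,
      forall x y, T x y -> T y x,
      forall x y x' y', T x y -> T x' y' -> T (x `&` x') (y `&` y') &
      forall x y x' y', T x y -> T x' y' -> T (x `|` x') (y `|` y')].

Definition tolerance_simple (d : Order.disp_t) (V : latticeType d) : Prop :=
  forall T : V -> V -> Prop, is_tolerance T ->
    (forall x y, T x y <-> x = y) \/ (forall x y, T x y).

(* Main.v *)
Require Import Defs.
From mathcomp Require Import all_boot all_order.
From Stdlib Require Import Classical.

Set Implicit Arguments.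
Unset Strict Implicit.
Unset Printing Implicit Defensive.

(** Call an equivalence trivial if it is equality or the full relation.  The
    maps that preserve an equivalence [k] preserve no other nontrivial one, so
    [k] gives the member [principal k], namely equality, [k] and the full
    relation; for nontrivial [k] it is an atom of the lattice, and every member
    [L] is the join of the [principal k] with [k] in [L].

    Let [T] be a tolerance and write 0 for the least member.  Say that [k] is
    absorbed if [T] relates 0 to [principal k].  If [T] relates [L] to [M] and
    [k] is in [M] but not in [L], meeting both sides with [principal k] shows
    that [k] is absorbed ([absorb_separated]).  So a tolerance other than
    equality absorbs some nontrivial equivalence, and it remains to see that
    it then absorbs all of them: the absorbed [principal k] are closed under
    join, hence [T] relates 0 to the top, and therefore relates any two members.

    Absorption spreads ([absorb_generated]): if [p] is absorbed, joining with
    [principal m] relates [principal m] to its join with [principal p], so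
    every [q] that lies in this join but not in [principal m] is absorbed.
    Members of the lattice are closed under meets and joins of equivalences,
    so [q] may be the meet or the join of [p] and [m] as soon as it is
    nontrivial and different from [m].  In this way absorption
    passes from a proper [p] down to the equivalence with only nontrivial block
    {x, y}, for any two distinct [p]-related points ([absorb_pair]), and from
    such a pair up to any proper equivalence relating its two points
    ([absorb_above_pair]).  When [A] has at least four points a block {x, y, z}
    is proper, so one can walk from the pair {x, y} to {x, z}, and hence to
    every pair and every equivalence. *)

Import Order.Theory.
Local Open Scope order_scope.

(** * Equivalences with one nontrivial block *)

Section Principal.
Variable A : finType.
Implicit Types (k p q m : {set A * A}) (f : {ffun A -> A}) (S : {set A}).
Implicit Types (L M : conlat A) (x y z w : A).

Lemma EqvP k :
  reflect [/\ forall x, (x, x) \in k,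
              forall x y, (x, y) \in k -> (y, x) \in k
            & forall y x z, (x, y) \in k -> (y, z) \in k -> (x, z) \in k]
          (k \in Eqv A).
Proof.
rewrite inE; apply: (iffP and3P) => -[r s t]; split.
- exact/forallP.
- by move=> x y; move/forallP/(_ x)/forallP/(_ y)/implyP: s.
- move=> y x z xy yz.
  by move/forallP/(_ x)/forallP/(_ y)/forallP/(_ z)/implyP: t; apply; apply/andP.
- exact/forallP.
- by apply/forallP => x; apply/forallP => y; apply/implyP; apply: s.
- apply/forallP => x; apply/forallP => y; apply/forallP => z.
  by apply/implyP => /andP[]; apply: t.
Qed.

Lemma preservesP f k :
  reflect (forall x y, (x, y) \in k -> (f x, f y) \in k) (preserves f k).
Proof.
apply: (iffP forallP) => [fk x y|fk x].
  by move/forallP/(_ y)/implyP: (fk x).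
by apply/forallP => y; apply/implyP/fk.
Qed.

Lemma Eqv_setI p q : p \in Eqv A -> q \in Eqv A -> p :&: q \in Eqv A.
Proof.
move=> /EqvP[pr ps pt] /EqvP[qr qs qt]; apply/EqvP; split.
- by move=> x; rewrite inE pr qr.
- by move=> x y /setIP[/ps yx /qs yx']; rewrite inE yx yx'.
- move=> y x z /setIP[pxy qxy] /setIP[pyz qyz].
  by apply/setIP; split; [apply: pt pyz | apply: qt qyz].
Qed.

(** Equality and the full relation are the extreme cases [block set0] and
    [block setT]. *)
Definition block S : {set A * A} :=
  [set u | (u.1 == u.2) || (u.1 \in S) && (u.2 \in S)].

Lemma in_block S x y :
  ((x, y) \in block S) = (x == y) || (x \in S) && (y \in S).
Proof. by rewrite inE. Qed.

Lemma block_Eqv S : block S \in Eqv A.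
Proof.
apply/EqvP; split=> [x|x y|y x z]; rewrite !in_block.
- by rewrite eqxx.
- by rewrite eq_sym andbC.
- case: eqP => [->|_] //=; case/andP=> xS yS.
  by case: eqP => [<-|_] /=; rewrite ?xS ?yS ?orbT //= => ->; rewrite orbT.
Qed.

Lemma sub_pair_block q z w :
  q \in Eqv A -> (z, w) \in q -> block [set z; w] \subset q.
Proof.
move=> /EqvP[qr qs _] zw; apply/subsetP => -[x y]; rewrite in_block !inE.
case: eqP => [-> _|_] /=; first exact: qr.
by case/andP=> /orP[]/eqP-> /orP[]/eqP->; rewrite ?qr // qs.
Qed.

(** * The atoms of the lattice *)

Lemma Con_in_calE (F : {set {ffun A -> A}}) : Con F \in calE A.
Proof. by apply/imsetP; exists F. Qed.

Definition principal k : conlat A :=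
  exist _ (Con [set f | preserves f k]) (Con_in_calE _).

Lemma mem_principal k : k \in Eqv A -> k \in val (principal k).
Proof. by move=> kE; rewrite in_Con kE; apply/forall_inP => f; rewrite inE. Qed.

(** Maps with at most two values suffice: those preserving [k] can move a pair
    outside [k] to any pair, and a pair of distinct points inside [k] to any
    pair inside [k]. *)
Lemma principalP k q : k \in Eqv A -> q \in val (principal k) ->
  [\/ q = block set0, q = block setT | q = k].
Proof.
move=> /EqvP[kr ks kt]; rewrite in_Con => /andP[/EqvP[qr qs qt] /forall_inP qP].
have pq f x y : preserves f k -> (x, y) \in q -> (f x, f y) \in q.
  by move=> fk; apply/preservesP/qP; rewrite inE.
have [qk|/subsetPn[[x y] xyq xyk]] := boolP (q \subset k); last first.
  constructor 2; apply/setP => -[u v]; rewrite in_block !inE orbT.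
  (* f collapses the k-class of x to u and everything else to v, so it even
     sends k into equality while moving (x, y) to (u, v). *)
  pose f := [ffun a => if (x, a) \in k then u else v].
  have := @pq f x y; rewrite !ffunE kr (negPf xyk); apply => //.
  apply/preservesP => a b ab; rewrite !ffunE.
  suff -> : ((x, a) \in k) = ((x, b) \in k) by apply: kr.
  by apply/idP/idP => [xa|xb]; [apply: kt ab | apply: kt (ks _ _ ab)].
have [qd|/subsetPn[[x y] xyq]] := boolP (q \subset block set0).
  constructor 1; apply/eqP; rewrite eqEsubset qd /=; apply/subsetP => -[u v].
  by rewrite in_block !inE orbF => /eqP->; apply: qr.
rewrite in_block !inE orbF => nxy.
constructor 3; apply/eqP; rewrite eqEsubset qk; apply/subsetP => -[u v] uv.
pose f := [ffun a => if a == x then u else v].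
have := @pq f x y; rewrite !ffunE eqxx eq_sym (negPf nxy); apply => //.
apply/preservesP => a b ab; rewrite !ffunE.
by do 2![case: eqP => _]; rewrite ?kr // ks.
Qed.

Lemma conlat_Eqv L k : k \in val L -> k \in Eqv A.
Proof. exact/subsetP/calE_sub/valP. Qed.

(** A member [Con F] contains [k] only if all maps of [F] preserve [k], and then
    it contains everything preserved by all the maps that preserve [k]. *)
Lemma principal_le L k : k \in val L -> principal k <= L.
Proof.
rewrite conlat_leE; case: L => _ /= /imsetP[F _ ->].
rewrite in_Con => /andP[kE /forall_inP Fk]; apply/subsetP => q.
rewrite !in_Con => /andP[-> /forall_inP qP]; apply/forall_inP => f /Fk fk.
by apply: qP; rewrite inE.
Qed.

Lemma le_principal L k : principal k <= L -> k \in Eqv A -> k \in val L.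
Proof. by rewrite conlat_leE => /subsetP kL /mem_principal/kL. Qed.

Lemma equality_in L : block set0 \in val L.
Proof.
case: L => _ /= /imsetP[F _ ->]; rewrite in_Con block_Eqv.
apply/forall_inP => f _; apply/preservesP => x y.
by rewrite !in_block !inE !orbF => /eqP->.
Qed.

Lemma full_in L : block setT \in val L.
Proof.
case: L => _ /= /imsetP[F _ ->]; rewrite in_Con block_Eqv.
apply/forall_inP => f _; apply/preservesP => x y.
by rewrite !in_block !inE !orbT.
Qed.

Definition bottom : conlat A := principal (block set0).

Lemma bottom_le L : bottom <= L.
Proof. exact/principal_le/equality_in. Qed.

(** By [principalP] only equality and the full relation can lie in both. *)
Lemma principal_meet_bottom L k :
  k \in Eqv A -> k \notin val L -> L `&` principal k = bottom.
Proof.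
move=> kE kL; apply/le_anti; rewrite bottom_le andbT conlat_leE.
apply/subsetP => q; rewrite conlat_meetE => /setIP[qL /(principalP kE)].
by case=> qE; rewrite qE in qL *; rewrite ?equality_in ?full_in ?qL // qL in kL *.
Qed.

Lemma mem_join_principal p m q : q \in Eqv A ->
  (forall f, preserves f p -> preserves f m -> preserves f q) ->
  p \in Eqv A -> m \in Eqv A -> q \in val (principal m `|` principal p).
Proof.
move=> qE pmq pE mE; set L := _ `|` _.
have pL : p \in val L by apply: le_principal pE; rewrite leUr.
have mL : m \in val L by apply: le_principal mE; rewrite leUl.
case: L pL mL => _ /= /imsetP[F _ ->]; rewrite !in_Con qE.
move=> /andP[_ /forall_inP Fp] /andP[_ /forall_inP Fm].
by apply/forall_inP => f fF; apply: pmq; [apply: Fp | apply: Fm].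
Qed.

(** * Absorption by a tolerance *)

Section Tolerance.
Variable T : conlat A -> conlat A -> Prop.
Hypothesis T_tol : is_tolerance T.

Definition absorbed k := T bottom (principal k).

Lemma absorb_separated L M k :
  T L M -> k \in val M -> k \notin val L -> absorbed k.
Proof.
move=> LM kM kL; case: T_tol => refl _ meet _.
have := meet _ _ _ _ LM (refl (principal k)).
rewrite principal_meet_bottom ?(conlat_Eqv kM) //.
by rewrite (meet_idPr (principal_le kM)).
Qed.

(** If [q] is preserved by all maps preserving [p] and [m], then it lies in the
    join of [principal m] and [principal p]; [T] relates this join to
    [principal m] itself. *)
Lemma absorb_generated p m q :
  p \in Eqv A -> m \in Eqv A -> q \in Eqv A -> absorbed p ->
  (forall f, preserves f p -> preserves f m -> preserves f q) ->
  q \notin [set block set0; block setT; m] -> absorbed q.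
Proof.
move=> pE mE qE Tp pmq; rewrite !inE => /norP[/norP[q0 q1] qm].
case: T_tol => refl _ _ join.
have := join _ _ _ _ (refl (principal m)) Tp.
rewrite (join_idPl (bottom_le _)) => /absorb_separated; apply.
  exact: mem_join_principal.
by apply/negP => /(principalP mE)[]; apply/eqP.
Qed.

Lemma block_neq_equality q x y :
  x != y -> (x, y) \in q -> q != block set0.
Proof.
move=> nxy xy; apply/eqP => q0.
by move: xy; rewrite q0 in_block (negPf nxy) inE.
Qed.

Lemma neq_full q x y : (x, y) \notin q -> q != block setT.
Proof. by apply: contraNneq => ->; rewrite in_block !inE orbT. Qed.

(** The pair {x, y} is the meet of [p] with the block {x, y, u}, where [u] lies
    outside the [p]-class of [x]. *)
Lemma absorb_pair p x y : p \in Eqv A -> p != block setT -> absorbed p ->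
  x != y -> (x, y) \in p -> absorbed (block [set x; y]).
Proof.
move=> pE p1 Tp nxy xy; have /EqvP[pr ps pt] := pE.
have [u xu] : exists u, (x, u) \notin p.
  apply/existsP; apply: contraNT p1; rewrite negb_exists => /forallP xp.
  apply/eqP/setP => -[a b]; rewrite in_block !inE orbT.
  by apply: (pt x); [apply: ps|]; apply/negPn/xp.
have yu : (y, u) \notin p by apply: contra xu; apply: pt.
have nxu : x != u by apply: contraNneq xu => <-; apply: pr.
have nyu : y != u by apply: contraNneq yu => <-; apply: pr.
have xyI : block [set x; y] = p :&: block [set x; y; u].
  apply/eqP; rewrite eqEsubset; apply/andP; split.
    apply: sub_pair_block; first by rewrite Eqv_setI ?block_Eqv.
    by rewrite inE xy in_block !inE !eqxx !orbT.
  apply/subsetP => -[a b]; rewrite inE !in_block !inE => /andP[].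
  have pu c : (c == x) || (c == y) -> (c, u) \notin p by case/orP => /eqP->.
  have [->|nab] //= := eqVneq a b.
  move=> ab /andP[/orP[aS|/eqP au] /orP[bS|/eqP bu]]; rewrite ?aS ?bS //.
  - by rewrite bu (negPf (pu _ aS)) in ab.
  - by move/ps: ab; rewrite au (negPf (pu _ bS)).
  - by rewrite au bu eqxx in nab.
apply: (@absorb_generated p (block [set x; y; u])); rewrite ?block_Eqv //.
  move=> f /preservesP fp /preservesP fm; rewrite xyI.
  by apply/preservesP => a b /setIP[/fp ab /fm ab']; rewrite inE ab ab'.
have xu_pair : (x, u) \notin block [set x; y].
  by rewrite in_block !inE !(eq_sym u) (negPf nxu) (negPf nyu) andbF.
rewrite !inE !negb_or (block_neq_equality nxy) ?(neq_full xu_pair) /=.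
  by apply: contraNneq xu_pair => ->; rewrite in_block !inE !eqxx !orbT.
by rewrite in_block !inE !eqxx !orbT.
Qed.

(** [q] is the join of the pair {z, w} with the equivalence obtained from [q] by
    isolating [z]. *)
Lemma absorb_above_pair q z w : q \in Eqv A -> q != block setT ->
  z != w -> (z, w) \in q -> absorbed (block [set z; w]) -> absorbed q.
Proof.
move=> qE q1 nzw zw Tzw; have /EqvP[qr qs qt] := qE.
pose m := q :&: block (~: [set z]).
apply: (@absorb_generated (block [set z; w]) m); rewrite ?block_Eqv //.
- by rewrite Eqv_setI ?block_Eqv.
- move=> f /preservesP fp /preservesP fm.
  have fq a b : b != z -> (a, b) \in q -> a != z -> (f a, f b) \in q.
    move=> nb ab na; have /setIP[] // : (f a, f b) \in m.
    by apply: fm; rewrite inE ab in_block !inE na nb orbT.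
  have fzw : (f z, f w) \in q.
    apply: (subsetP (sub_pair_block qE zw)); apply: fp.
    by rewrite in_block !inE !eqxx !orbT.
  have fzb b : b != z -> (z, b) \in q -> (f z, f b) \in q.
    move=> nb zb; apply: (qt _ _ _ fzw); apply: fq => //; last by rewrite eq_sym.
    by apply: qt zb; apply: qs.
  apply/preservesP => a b; have [->|na] := eqVneq a z.
    by have [->|nb] := eqVneq b z; [rewrite qr | apply: fzb].
  have [->|nb] := eqVneq b z; last by move=> ab; apply: fq.
  by move=> /qs za; apply/qs/fzb.
- rewrite !inE !negb_or q1 (block_neq_equality nzw zw) /=.
  apply/eqP => qm; move: zw; rewrite qm inE in_block !inE eqxx (negPf nzw).
  by rewrite andbF.
Qed.

Hypothesis card_A : (4 <= #|A|)%N.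

(** The passage goes through the block {x, y, z}, which is a proper equivalence
    because it misses a fourth point. *)
Lemma absorb_move_pair x y z : x != y -> x != z ->
  absorbed (block [set x; y]) -> absorbed (block [set x; z]).
Proof.
move=> nxy nxz Txy; pose S := [set x; y; z].
have S1 : block S != block setT.
  have [u uS] : exists u, u \notin S.
    apply/existsP; apply: contraTT card_A; rewrite negb_exists => /forallP SA.
    have -> : #|A| = #|S|.
      by rewrite -cardsT; apply: eq_card => u; rewrite (negPn (SA u)) inE.
    rewrite -ltnNge ltnS (leq_trans (leq_card_setU _ _)) // cards1 cards2.
    by case: (x != y).
  apply: (@neq_full _ x u); rewrite in_block (negPf uS) andbF orbF.
  by apply: contraNneq uS => <-; rewrite !inE eqxx.
apply: (@absorb_pair (block S)); rewrite ?block_Eqv //.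
  apply: (@absorb_above_pair _ x y); rewrite ?block_Eqv //.
all: by rewrite in_block !inE !eqxx !orbT.
Qed.

Lemma absorb_all p q : p \in Eqv A -> p != block set0 -> p != block setT ->
  absorbed p -> q \in Eqv A -> absorbed q.
Proof.
move=> pE p0 p1 Tp qE; case: T_tol => refl _ _ _.
have related k : k \in Eqv A -> k != block set0 ->
    exists x, exists2 y, x != y & (x, y) \in k.
  move=> /EqvP[kr _ _] k0.
  have [kd|/subsetPn[[x y] xyk]] := boolP (k \subset block set0).
    case/eqP: k0; apply/eqP; rewrite eqEsubset kd; apply/subsetP => -[u v].
    by rewrite in_block !inE orbF => /eqP->.
  by rewrite in_block !inE orbF => nxy; exists x, y.
have trivial k : (forall L, k \in val L) -> absorbed k.
  move=> kL; rewrite /absorbed; suff -> : principal k = bottom by apply: refl.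
  by apply/le_anti; rewrite bottom_le principal_le.
have [->|q0] := eqVneq q (block set0); first exact/trivial/equality_in.
have [->|q1] := eqVneq q (block setT); first exact/trivial/full_in.
have [x [y nxy xy]] := related p pE p0.
have [z [w nzw zw]] := related q qE q0.
have Txy := absorb_pair pE p1 Tp nxy xy.
apply: (absorb_above_pair qE q1 nzw zw).
have [xz|nxz] := eqVneq x z.
  by move: Txy nxy; rewrite xz => Txy nxy; apply: absorb_move_pair Txy.
apply: (@absorb_move_pair _ x) => //; first by rewrite eq_sym.
by rewrite setUC; apply: absorb_move_pair Txy.
Qed.

(** The top of the lattice is a finite join of members [principal k], so [T]
    relates [bottom] to it, hence every member to it. *)
Lemma absorb_all_full : (forall k, k \in Eqv A -> absorbed k) ->
  forall L M, T L M.
Proof.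
move=> Tall; case: T_tol => refl sym meet join.
have [J TJ maxJ] : exists2 J, T bottom J & forall L, L <= J.
  suff [J TJ maxJ] : exists2 J, T bottom J &
      forall k, k \in enum (Eqv A) -> principal k <= J.
    exists J => // L; rewrite conlat_leE; apply/subsetP => k kL.
    have kE := conlat_Eqv kL.
    by apply: le_principal (kE); apply: maxJ; rewrite mem_enum.
  have: {subset enum (Eqv A) <= Eqv A} by move=> k; rewrite mem_enum.
  elim: (enum _) => [|k s IHs] sE; first by exists bottom.
  have [|J TJ maxJ] := IHs; first by move=> q qs; apply: sE; rewrite inE qs orbT.
  exists (principal k `|` J) => [|q].
    by rewrite -(joinxx bottom); apply: join => //; apply/Tall/sE/mem_head.
  by rewrite inE => /predU1P[->|/maxJ qJ]; [apply: leUl | apply: lexUr].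
have TLJ L : T L J.
  have := join _ _ _ _ (refl L) TJ.
  by rewrite (join_idPl (bottom_le L)) (join_idPr (maxJ L)).
move=> L M; have := meet _ _ _ _ (TLJ L) (sym _ _ (TLJ M)).
by rewrite (meet_idPl (maxJ L)) (meet_idPr (maxJ M)).
Qed.

End Tolerance.
End Principal.

Theorem theorem7p6 (A : finType) (hA : (4 <= #|A|)%N) : tolerance_simple (conlat A).
Proof.
move=> T T_tol; have [refl sym _ _] := T_tol.
have [[L [M [LM nLM]]]|Teq] := classic (exists L M, T L M /\ L <> M); last first.
  left=> L M; split=> [LM|->]; last exact: refl.
  by have [//|nLM] := classic (L = M); case: Teq; exists L, M.
right.
have [L' [M' [L'M' /subsetPn[k kM kL]]]] :
    exists L' M', T L' M' /\ ~~ (val M' \subset val L').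
  have [ML|?] := boolP (val M \subset val L); last by exists L, M.
  exists M, L; split; first exact: sym.
  by apply/negP => LsM; case: nLM; apply/val_inj/eqP; rewrite eqEsubset LsM.
apply: absorb_all_full => // q qE.
apply: (absorb_all T_tol hA (conlat_Eqv kM)) qE.
- by apply: contraNneq kL => ->; apply: equality_in.
- by apply: contraNneq kL => ->; apply: full_in.
- exact: absorb_separated L'M' kM kL.
Qed.
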